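(* Let $A$ be a locally compact abelian group and let $C$ be a compact totally disconnected abelian group. Then every pure extension $0\to A\stackrel{\phi}{\to}B\stackrel{\psi}{\to}C\to 0$ of $A$ by $C$ in $\ell$ is a $TFU$ extension.
   Context: All groups are Hausdorff topological abelian groups, written additively. $\ell$ is the category of locally compact abelian (LCA) groups with continuous homomorphisms as morphisms. A morphism is proper if it is open onto its image. An extension of $A$ by $C$ in $\ell$ is a short exact sequence $0\to A\stackrel{\phi}{\to}B\stackrel{\psi}{\to}C\to 0$ in $\ell$ in which $\phi$ and $\psi$ are proper morphisms. A subgroup $H$ of $G$ is pure if $H\cap nG=nH$ for every positive integer $n$; the extension is pure if $\phi(A)$ is pure in $B$. For a group $G$, $G^{(1)}=\bigcap_{n\ge 1}nG$ is the first Ulm subgroup, and $\overline{S}$ denotes the closure of $S$. An extension $0\to A\stackrel{\phi}{\to}B\stackrel{\psi}{\to}C\to 0$ in $\ell$ is a $TFU$ extension if $0\to\overline{A^{(1)}}\stackrel{\overline{\phi}}{\to}\overline{B^{(1)}}\stackrel{\overline{\psi}}{\to}\overline{C^{(1)}}\to 0$ is an extension, where $\overline{\phi}=\phi|_{\overline{A^{(1)}}}$ and $\overline{\psi}=\psi|_{\overline{B^{(1)}}}$. *)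

(* Defs.v *)
From HB Require Import structures.
From mathcomp Require Import all_boot all_order all_algebra.
From mathcomp Require Import all_classical all_reals all_analysis.

Set Implicit Arguments.
Unset Strict Implicit.
Unset Printing Implicit Defensive.

Import GRing.Theory.

Local Open Scope classical_set_scope.
Local Open Scope ring_scope.

(* Objects and morphisms of the category of locally compact abelian groups;
   Hausdorffness is part of the structure. *)
HB.mixin Record isLCA G & Topological G := {
  lca_hausdorff : hausdorff_space G ;
  lca_locally_compact : locally_compact [set: G]
}.

#[short(type="lcaType")]
HB.structure Definition LCA := {G of TopologicalZmodule G & isLCA G}.

#[short(type="lcaHom")]
HB.structure Definition LCAHom (A B : lcaType) :=
  {f of @isContinuous A B f & @GRing.Additive A B f}.

Definition nmul_set (G : zmodType) (n : nat) (S : set G) : set G :=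
  [set x *+ n | x in S].

(* First Ulm subgroup of the underlying abstract group. *)
Definition ulm1 (G : zmodType) : set G :=
  \bigcap_(n in [set n : nat | (0 < n)%N]) nmul_set n [set: G].
Arguments ulm1 G : clear implicits.

Definition pure_subgroup (G : zmodType) (H : set G) : Prop :=
  forall n : nat, (0 < n)%N -> H `&` nmul_set n [set: G] = nmul_set n H.

(* [subspace (range f)] carries the relative topology of [range f]. *)
Definition proper_hom (A B : lcaType) (f : lcaHom A B) : Prop :=
  forall U : set A, open U -> open (f @` U : set (subspace (range f))).

Definition short_exact (A B C : lcaType) (phi : lcaHom A B) (psi : lcaHom B C)
    : Prop :=
  [/\ injective phi, range phi = psi @^-1` [set 0] & range psi = [set: C]].

Definition extension (A B C : lcaType) (phi : lcaHom A B) (psi : lcaHom B C)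
    : Prop :=
  [/\ short_exact phi psi, proper_hom phi & proper_hom psi].

Definition pure_extension (A B C : lcaType) (phi : lcaHom A B)
    (psi : lcaHom B C) : Prop :=
  extension phi psi /\ pure_subgroup (range phi).

Lemma ulm1_zmod_closed (G : zmodType) :
  ulm1 G 0 /\ (forall x y, ulm1 G x -> ulm1 G y -> ulm1 G (x - y)).
Proof.
split; first by move=> n _; exists 0 => //; rewrite mul0rn.
move=> x y Gx Gy n n0; have [a _ <-] := Gx n n0; have [b _ <-] := Gy n n0.
by exists (a - b) => //; rewrite mulrnBl.
Qed.

Lemma closure_ulm1_zmod_closed (G : topologicalZmodType) :
  zmod_closed [pred x : G | x \in closure (ulm1 G)].
Proof.
have [u0 uB] := ulm1_zmod_closed G.
split=> [|x y]; rewrite !inE; first exact: subset_closure.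
move=> cx cy W /(@sub_continuous G (x, y)) [[U V] /= [Ux Vy] UVW].
have [a [ua Ua]] := cx _ Ux; have [b [ub Vb]] := cy _ Vy.
by exists (a - b); split; [exact: uB|exact: (UVW (a, b))].
Qed.

(* The closure of the first Ulm subgroup as a topological group in its own
   right, with the subgroup operations and the subspace topology; it is an
   [lcaType] when [G] is. *)
Definition closure_ulm1 (G : topologicalZmodType) : Type :=
  set_type (closure (ulm1 G)).

HB.instance Definition _ (G : topologicalZmodType) :=
  SubChoice.copy (closure_ulm1 G) (set_type (closure (ulm1 G))).
HB.instance Definition _ (G : topologicalZmodType) :=
  Topological.copy (closure_ulm1 G) (set_type (closure (ulm1 G))).
HB.instance Definition _ (G : topologicalZmodType) :=
  GRing.SubChoice_isSubZmodule.Build G _ (closure_ulm1 G)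
    (closure_ulm1_zmod_closed G).

Lemma closure_ulm1_val_continuous (G : topologicalZmodType) :
  continuous (\val : closure_ulm1 G -> G).
Proof. exact: initial_continuous. Qed.

Lemma closure_ulm1_continuous (G : topologicalZmodType) (T : topologicalType)
    (f : T -> closure_ulm1 G) :
  continuous ((\val : closure_ulm1 G -> G) \o f) -> continuous f.
Proof. exact: continuous_comp_initial. Qed.

Lemma closure_ulm1_sub_continuous (G : topologicalZmodType) :
  continuous (fun x : closure_ulm1 G * closure_ulm1 G => x.1 - x.2).
Proof.
apply: closure_ulm1_continuous => x.
rewrite (_ : _ \o _ = (fun z : G * G => z.1 - z.2) \o
  (fun z : closure_ulm1 G * closure_ulm1 G => (val z.1, val z.2))); last first.
  by apply/funext => z; exact: (raddfB (\val : closure_ulm1 G -> G)).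
apply: continuous_comp; last exact: sub_continuous.
apply: cvg_pair.
- apply: (@continuous_comp _ _ _ fst (\val : closure_ulm1 G -> G)).
    exact: cvg_fst.
  exact: closure_ulm1_val_continuous.
- apply: (@continuous_comp _ _ _ snd (\val : closure_ulm1 G -> G)).
    exact: cvg_snd.
  exact: closure_ulm1_val_continuous.
Qed.

HB.instance Definition _ (G : topologicalZmodType) :=
  PreTopologicalNmodule_isTopologicalZmodule.Build (closure_ulm1 G)
    (@closure_ulm1_sub_continuous G).

Lemma closure_ulm1_hausdorff (G : lcaType) : hausdorff_space (closure_ulm1 G).
Proof.
move=> p q pq; apply: val_inj; apply: (@lca_hausdorff G) => U V pU qV.
have [z [Uz Vz]] := pq _ _ (closure_ulm1_val_continuous pU)
  (closure_ulm1_val_continuous qV).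
by exists (val z).
Qed.

Lemma closure_ulm1_compact_preimage (G : topologicalZmodType) (K : set G) :
  compact K -> compact ((\val : closure_ulm1 G -> G) @^-1` K).
Proof.
move=> cK F FF FK.
have [p [Kp clp]] := cK (\val @ F) _ FK.
have Hp : closure (ulm1 G) p.
  apply: closed_closure => U Up.
  have [] := clp (closure (ulm1 G)) U _ Up; last by move=> z [? ?]; exists z.
  by apply: (@filterE _ F) => z; exact: set_mem (valP z).
exists (exist _ p (mem_set Hp)); split => // U V FU [_ [[W oW <-]]] /= Wp WV.
have [] := clp (\val @` U) W; first by apply: (@filterS _ F _ U) => // z Uz; exists z.
  exact: open_nbhs_nbhs.
by move=> _ [[z Uz <-] Wz]; exists z; split => //; exact: WV.
Qed.

Lemma closure_ulm1_locally_compact (G : lcaType) :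
  locally_compact [set: closure_ulm1 G].
Proof.
move=> x _; have [K xK [cK _]] := @lca_locally_compact G (val x) I.
have {}xK : nbhs (\val x) K by apply: (@filterS _ (nbhs (\val x)) _ _ _ _ xK) => y /(_ I).
exists ((\val : closure_ulm1 G -> G) @^-1` K).
  have vK : nbhs x ((\val : closure_ulm1 G -> G) @^-1` K).
    exact: (closure_ulm1_val_continuous xK).
  by apply: (@filterS _ (nbhs x) _ _ _ _ vK) => y Ky _.
have cpt := closure_ulm1_compact_preimage cK.
split => //; exact: (compact_closed (@closure_ulm1_hausdorff G)).
Qed.

HB.instance Definition _ (G : lcaType) :=
  isLCA.Build (closure_ulm1 G) (@closure_ulm1_hausdorff G)
    (@closure_ulm1_locally_compact G).

Lemma closure_ulm1_hom (A B : lcaType) (f : lcaHom A B) (x : closure_ulm1 A) :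
  f (val x) \in closure (ulm1 B).
Proof.
apply/mem_set => U /(@cts_fun _ _ f) fU.
have [a [ua Ua]] := set_mem (valP x) _ fU.
exists (f a); split => // n n0; have [b _ <-] := ua n n0.
by exists (f b) => //; rewrite raddfMn.
Qed.

(* Restriction of [f] to the closures of the first Ulm subgroups, an [lcaHom]. *)
Definition closure_ulm1_restr (A B : lcaType) (f : lcaHom A B)
    (x : closure_ulm1 A) : closure_ulm1 B :=
  exist _ (f (val x)) (closure_ulm1_hom f x).

Lemma closure_ulm1_restr_continuous (A B : lcaType) (f : lcaHom A B) :
  continuous (closure_ulm1_restr f).
Proof.
apply: closure_ulm1_continuous => x.
apply: (@continuous_comp _ _ _ (\val : closure_ulm1 A -> A) f).
- exact: closure_ulm1_val_continuous.
- exact: cts_fun.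
Qed.

Lemma closure_ulm1_restr_zmod_morphism (A B : lcaType) (f : lcaHom A B) :
  zmod_morphism (closure_ulm1_restr f).
Proof. by move=> x y; apply: val_inj; rewrite /= !raddfB. Qed.

HB.instance Definition _ (A B : lcaType) (f : lcaHom A B) :=
  isContinuous.Build (closure_ulm1 A) (closure_ulm1 B) (closure_ulm1_restr f)
    (@closure_ulm1_restr_continuous A B f).
HB.instance Definition _ (A B : lcaType) (f : lcaHom A B) :=
  GRing.isZmodMorphism.Build (closure_ulm1 A) (closure_ulm1 B)
    (closure_ulm1_restr f) (@closure_ulm1_restr_zmod_morphism A B f).

Definition TFU_extension (A B C : lcaType) (phi : lcaHom A B)
    (psi : lcaHom B C) : Prop :=
  extension phi psi /\
  @extension (closure_ulm1 A) (closure_ulm1 B) (closure_ulm1 C)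
    (closure_ulm1_restr phi) (closure_ulm1_restr psi).

(* Main.v *)
Require Import Defs.
From HB Require Import structures.
From mathcomp Require Import all_boot all_order all_algebra.
From mathcomp Require Import all_classical all_reals all_analysis.

(** A compact totally disconnected group has a neighbourhood basis at 0 of open
subgroups [H], and by compactness some [n > 0] satisfies [n C ⊆ H]; hence
[C^(1) = 0]. So [B^(1)] lies in [ker psi = phi(A)], and purity of [phi(A)]
gives [B^(1) = phi(A^(1))]. As [phi] is a homeomorphism onto the closed subgroup
[ker psi], it maps the closure of [A^(1)] onto the closure of [B^(1)]. *)

Import GRing.Theory.

Local Open Scope classical_set_scope.
Local Open Scope ring_scope.

(** * Quasi-components of compact Hausdorff spaces *)

Definition quasi_component (T : topologicalType) (x : T) : set T :=
  \bigcap_(D in [set D : set T | D x /\ clopen D]) D.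

(** Otherwise the sets [D \ W], with [D] clopen around [x], generate a proper filter. A cluster
    point of it avoids the open [W] but lies in every closed [D]. *)
Lemma quasi_component_sub_open (T : topologicalType) (x : T) (W : set T) :
  compact [set: T] -> open W -> quasi_component T x `<=` W ->
  exists D : set T, [/\ D x, clopen D & D `<=` W].
Proof.
move=> cT oW QW; apply: contrapT => noD.
pose F := filter_from [set D : set T | D x /\ clopen D] (fun D => D `\` W).
have PF : ProperFilter F.
  apply: filter_from_proper.
    apply: filter_from_filter.
      by exists setT; split => //; exact: clopenT.
    move=> D E [Dx cD] [Ex cE]; exists (D `&` E).
      by split; [split|exact: clopenI].
    by move=> y [[Dy Ey] nWy].
  move=> D [Dx cD]; apply/set0P/negP => /eqP DW0; apply: noD; exists D.
  by split => // y Dy; apply: contrapT => nWy; rewrite -[False]/(set0 y) -DW0.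
have [p [_ clp]] := cT F PF (@filterT _ F _).
have nWp : ~ W p.
  move=> Wp; have nW : nbhs p W by exact: open_nbhs_nbhs.
  have [|y [[_ nWy] Wy]] := clp (setT `\` W) W _ nW.
    by exists setT => //; split => //; exact: clopenT.
  exact: nWy.
apply: nWp; apply: QW => D [Dx cD]; apply: contrapT => nDp.
have nD : nbhs p (~` D).
  by apply: open_nbhs_nbhs; split => //; apply: closed_openC; case: cD.
have [|y [[Dy _] nDy]] := clp (D `\` W) _ _ nD; first by exists D.
exact: nDy.
Qed.

Lemma quasi_component_closed (T : topologicalType) (x : T) :
  closed (quasi_component T x).
Proof. by apply: closed_bigI => D [_ []]. Qed.

Lemma quasi_component_refl (T : topologicalType) (x : T) :
  quasi_component T x x.
Proof. by move=> D []. Qed.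

Lemma quasi_component_connected (T : topologicalType) (x : T) :
  hausdorff_space T -> compact [set: T] -> connected (quasi_component T x).
Proof.
move=> hT cT B [b Bb] [P oP BP] [Z cZ BZ].
set Q := quasi_component T x in BP BZ *.
have clB : closed B.
  by rewrite BZ; apply: closedI => //; exact: quasi_component_closed.
(* Normality separates the two pieces [B] and [Q \ P]: [B] lies in an open [U] inside [V], and
   [closure V] misses [Q \ P]. *)
have snB : set_nbhs B (~` (Q `\` P)).
  move=> y; rewrite BP => -[Qy Py]; apply: (filterS (P := P)).
    by move=> z Pz [].
  exact: open_nbhs_nbhs.
have [V sV clV] := compact_normal hT cT clB snB.
have /set_nbhsP [U [oU BU UV]] := sV.
have oW : open (~` closure V) by apply: closed_openC; exact: closed_closure.
have QUW : Q `<=` U `|` ~` closure V.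
  move=> y Qy; have [Py|nPy] := pselect (P y).
    by left; apply: BU; rewrite BP.
  by right => /clV; apply.
have [D [Dx [oD cD] DUW]] :=
  quasi_component_sub_open _ x _ cT (openU oU oW) QUW.
have UW y : U y -> ~ (~` closure V) y.
  by move=> Uy; apply; apply: subset_closure; exact: UV.
(* [D] avoids [closure V \ U], so [U] and [closure V] have the same trace on [D]: one gives
   openness, the other closedness. *)
have cDU : clopen (D `&` U).
  split; first exact: openI.
  rewrite (_ : _ `&` _ = D `&` closure V).
    by apply: closedI => //; exact: closed_closure.
  apply/seteqP; split => y [Dy].
    by move=> /UV ?; split => //; exact: subset_closure.
  by move=> Vy; split => //; case: (DUW y Dy).
have cDW : clopen (D `\` U).
  split; last by apply: closedI => //; exact: open_closedC.
  rewrite (_ : _ `\` _ = D `&` ~` closure V); first exact: openI.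
  apply/seteqP; split => y [Dy].
    by move=> nUy; split => //; case: (DUW y Dy).
  by move=> Wy; split => // /UW.
(* Whichever of [D & U] and [D \ U] contains [x] is clopen, so it contains all of [Q]. The first
   forces [Q = B]; the second would miss [b]. *)
have [Ux|nUx] := pselect (U x).
  apply/seteqP; split; first by move=> y; rewrite BP => -[].
  move=> y Qy; rewrite BP; split => //; apply: contrapT => nPy.
  have [_ Uy] : (D `&` U) y by exact: Qy.
  have Vy : closure V y by apply: subset_closure; exact: UV.
  by case: (clV y Vy).
have Qb : Q b by move: Bb; rewrite BP => -[].
have [_] : (D `\` U) b by exact: Qb.
by move/(_ (BU _ Bb)).
Qed.

(** The quasi-component of [x] is connected, hence reduced to [x], so some clopen set around [x]
    excludes [y]. *)
Lemma compact_totally_disconnected_zero_dimensional (T : topologicalType) :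
  hausdorff_space T -> compact [set: T] -> totally_disconnected [set: T] ->
  zero_dimensional T.
Proof.
move=> hT cT tdT x y xy.
have nQy : ~ quasi_component T x y.
  move=> Qy; move/eqP: xy; apply; apply/esym.
  rewrite -[y = x]/([set x] y) -(tdT x I); move: Qy.
  apply: connected_component_max => //; first exact: quasi_component_refl.
  exact: quasi_component_connected.
apply: contrapT => noU; apply: nQy => D [Dx cD].
by apply: contrapT => nDy; apply: noU; exists D.
Qed.

(** * Multiples in compact groups and the vanishing of the first Ulm subgroup *)

Section CompactGroup.
Variable G : topologicalZmodType.
Hypothesis cG : compact [set: G].

(** The subgroup of all [h] with [K + h = K]. For clopen [K] it is an open subgroup, and it lies in
    [K] as soon as [K] contains 0. *)
Definition translation_stabilizer (K : set G) : set G :=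
  [set h | forall k, K k <-> K (k + h)].

Lemma translation_stabilizerB (K : set G) (g h : G) :
  translation_stabilizer K g -> translation_stabilizer K h ->
  translation_stabilizer K (g - h).
Proof.
by move=> Kg Kh k; rewrite (Kh (k + (g - h))) addrA subrK; exact: Kg.
Qed.

Lemma translation_stabilizerMn (K : set G) (g : G) (n : nat) :
  translation_stabilizer K g -> translation_stabilizer K (g *+ n).
Proof.
move=> Kg; elim: n => [|n IH] k; first by rewrite mulr0n addr0.
by rewrite mulrS addrA -IH; exact: Kg.
Qed.

(** A tube argument: addition is continuous at each [(k, 0)], and compactness of [K] makes the
    neighbourhood of 0 uniform in [k]. *)
Lemma near_translate_clopen (K : set G) : clopen K ->
  \forall h \near (0 : G), K `<=` [set k | K (k + h)].
Proof.
move=> [oK cK].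
have /compact_near_coveringP cov : compact K by exact: (subclosed_compact _ cG).
apply: (cov G (nbhs (0 : G)) (fun h k => K (k + h))) => k Kk.
have := @add_continuous G (k, 0) K; rewrite /= addr0.
by apply; exact: open_nbhs_nbhs.
Qed.

Lemma translation_stabilizer_nbhs0 (K : set G) : clopen K ->
  nbhs (0 : G) (translation_stabilizer K).
Proof.
move=> cK; have nK := near_translate_clopen K cK.
have nNK := near_translate_clopen (~` K) (clopenC K cK).
apply: filterS2 nK nNK => h KK NK k; split; first exact: KK.
by move=> Kkh; apply: contrapT => /NK; apply.
Qed.

Lemma nbhs_translate (H : set G) (p : G) :
  nbhs (0 : G) H -> nbhs p [set q | H (q - p)].
Proof.
move=> H0; have := @sub_continuous G (p, p) H; rewrite /= subrr => /(_ H0).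
move=> [[U V] /= [Up Vp] UVH]; apply: filterS Up => q Uq.
by apply: (UVH (q, p)); split => //=; exact: nbhs_singleton.
Qed.

(** Pigeonhole: the multiples of [c] cluster at some [p], so two of them lie in [p + H], and their
    difference lies in [H]. *)
Lemma multiple_in_translation_stabilizer (K : set G) (c : G) : clopen K ->
  exists2 n : nat, (0 < n)%N & translation_stabilizer K (c *+ n).
Proof.
move=> cK; pose H := translation_stabilizer K.
have [|p [_ clp]] := cG ((fun n : nat => c *+ n) @ \oo) _; first exact: filterT.
have nH : nbhs p [set q | H (q - p)].
  by apply: nbhs_translate; exact: translation_stabilizer_nbhs0.
have visit N : exists2 n, (N <= n)%N & H (c *+ n - p).
  have [|y [[n Nn <-] Hn]] :=
    clp ((fun n => c *+ n) @` [set n | (N <= n)%N]) _ _ nH.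
    by exists N => // n Nn; exists n.
  by exists n.
(* Starting the second visit at [i.+1] makes [j - i] positive. *)
have [i _ Hi] := visit 0; have [j ij Hj] := visit i.+1.
exists (j - i)%N; first by rewrite subn_gt0.
rewrite mulrnBr; last exact: ltnW.
have := translation_stabilizerB K _ _ Hj Hi.
by rewrite opprB addrA subrK.
Qed.

Lemma uniform_multiple_in_translation_stabilizer (K : set G) : clopen K ->
  exists2 n : nat, (0 < n)%N & forall c, translation_stabilizer K (c *+ n).
Proof.
move=> cK; pose H := translation_stabilizer K.
have H0 : nbhs (0 : G) H by exact: translation_stabilizer_nbhs0.
have /compact_near_coveringP cov := cG.
(* A multiplier [m] valid at [c] is valid on all of [c + H]. Every [m <= n] divides the factorial of
   [n], so the property holds eventually in [n], and compactness gives a common [N]. *)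
have [c _|N _ NH] := cov nat \oo (fun n c => H (c *+ n`!)) _; last first.
  by exists N`!; [exact: fact_gt0|move=> c; exact: (NH N (leqnn N) c I)].
have [m m0 Hm] := multiple_in_translation_stabilizer K c cK.
exists ([set d | H (d - c)], [set n | (m <= n)%N]).
  by split; [exact: nbhs_translate|exists m].
move=> [d n] /= [Hd mn].
have /dvdnP [q ->] : (m %| n`!)%N by apply: dvdn_fact; rewrite m0.
rewrite mulnC mulrnA; apply: translation_stabilizerMn.
(* The sum is written with differences to fit [translation_stabilizerB]. *)
have -> : d *+ m = (d - c) *+ m - (0 - c *+ m).
  by rewrite mulrnBl sub0r opprK subrK.
apply: translation_stabilizerB; first exact: translation_stabilizerMn.
apply: translation_stabilizerB => //.
by have := translation_stabilizerMn K _ 0 Hm; rewrite mulr0n.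
Qed.

Lemma ulm1_zero_dimensional : zero_dimensional G -> ulm1 G = [set 0].
Proof.
move=> zG; apply/seteqP; split; last first.
  by move=> _ -> n _; exists 0; rewrite ?mul0rn.
move=> x ux; apply: contrapT => x0; have /eqP : x <> 0 by [].
rewrite eq_sym => /zG [K [cK K0 nKx]].
have [n n0 Kn] := uniform_multiple_in_translation_stabilizer K cK.
have [c _ cx] := ux n n0.
(* Translating 0, a point of [K], by [x = c *+ n] stays in [K]. *)
by apply: nKx; rewrite -cx -(add0r (c *+ n)); exact: (Kn c 0).1.
Qed.

End CompactGroup.

(** * Transfer of Ulm subgroups and their closures along [phi] *)

Lemma proper_hom_image_open (A B : lcaType) (f : lcaHom A B) (W : set A) :
  proper_hom f -> open W -> injective f ->
  exists2 V : set B, open V & forall a, W a <-> V (f a).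
Proof.
move=> pf oW fI; have /open_subspaceP [V oV VW] := pf W oW.
exists V => // a; split => [Wa|Va].
  have : (f @` W `&` range f) (f a) by split; exists a.
  by rewrite -VW => -[].
have : (V `&` range f) (f a) by split => //; exists a.
by rewrite VW => -[[a' Wa' /fI <-]].
Qed.

(** If [f a] is divisible by [n] in [B], purity gives [f a = f (a' *+ n)], and injectivity gives
    [a = a' *+ n]. *)
Lemma pure_ulm1 (A B : zmodType) (f : {additive A -> B}) :
  injective f -> pure_subgroup (range f) ->
  ulm1 B `&` range f = f @` ulm1 A.
Proof.
move=> fI pf; apply/seteqP; split=> [b [+ [a _ ab]]|_ [a ua <-]].
  rewrite -{b}ab => uB; exists a => // n n0.
  have : (range f `&` nmul_set n [set: B]) (f a).
    by split; [exists a|exact: uB].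
  rewrite pf // => -[_ [a' _ <-]]; rewrite -raddfMn => /fI <-.
  by exists a'.
split; last by exists a.
by move=> n n0; have [a' _ <-] := ua n n0; exists (f a'); rewrite // raddfMn.
Qed.

(** Supplies the lifting half of exactness in the middle for the restricted sequence. *)
Lemma range_closure_ulm1_restr (A B C : lcaType) (phi : lcaHom A B)
    (psi : lcaHom B C) (b : B) :
  pure_extension phi psi -> ulm1 C = [set 0] -> closure (ulm1 B) b ->
  exists2 a, closure (ulm1 A) a & phi a = b.
Proof.
move=> [[[phiI rphi rpsi] pphi _] pure] uC clb.
have uBr : ulm1 B `<=` range phi.
  move=> x ux; rewrite rphi /preimage /= -[_ = _]/([set 0] _) -uC => n n0.
  by have [y _ <-] := ux n n0; exists (psi y); rewrite // raddfMn.
have uB : ulm1 B = phi @` ulm1 A.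
  by rewrite -pure_ulm1 //; apply/esym/setIidPl.
have clr : closed (range phi).
  rewrite rphi; apply: preimage_closed; last first.
    apply: accessible_closed_set1; apply: hausdorff_accessible.
    exact: lca_hausdorff.
  by move=> x _; exact: cts_fun.
have [a _ ab] : range phi b by exact/clr/(closureS uBr).
exists a => //; move=> W; rewrite nbhsE => -[W' [oW' W'a] W'W].
(* [V] is an open neighbourhood of [b] that pulls back to [W'], so a point of [ulm1 B] in [V] comes
   from a point of [ulm1 A] in [W']. *)
have [V oV WV] := proper_hom_image_open _ _ phi W' pphi oW' phiI.
have [|b' [ub' Vb']] := clb V _.
  by apply: open_nbhs_nbhs; split => //; rewrite -ab -WV.
move: ub'; rewrite uB => -[a' ua' ab']; exists a'; split => //.
by apply: W'W; rewrite WV ab'.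
Qed.

Theorem corollary2p6 (A C : lcaType) (compact_C : compact [set: C])
    (tdisc_C : totally_disconnected [set: C]) (B : lcaType)
    (phi : lcaHom A B) (psi : lcaHom B C) :
  pure_extension phi psi -> TFU_extension phi psi.
Proof.
move=> pe; have [ext _] := pe; split => //.
have [[phiI rphi rpsi] pphi ppsi] := ext.
have hC := @lca_hausdorff C.
have uC : ulm1 C = [set 0].
  apply: ulm1_zero_dimensional => //.
  exact: compact_totally_disconnected_zero_dimensional.
(* The closure of 0 is 0 in a Hausdorff group, so the third term is trivial; surjectivity and
   properness of the restricted [psi] follow from this. *)
have C0 (c : closure_ulm1 C) : c = 0.
  have cl0 : closure (ulm1 C) `<=` [set 0].
    by rewrite uC; apply: accessible_closed_set1; exact: hausdorff_accessible.
  by apply: val_inj; exact/cl0/set_mem/(valP c).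
split; [split| |].
- by move=> x y /(congr1 val) /phiI /val_inj.
- apply/seteqP; split=> [b _|b _]; first exact: C0.
  have [a cla ab] :=
    range_closure_ulm1_restr _ _ _ phi psi (val b) pe uC (set_mem (valP b)).
  by exists (exist _ a (mem_set cla)) => //; exact: val_inj.
- by apply/seteqP; split=> // c _; exists 0 => //; rewrite [RHS]C0; exact: C0.
- move=> U [W oW <-].
  have [V oV WV] := proper_hom_image_open _ _ phi W pphi oW phiI.
  apply/open_subspaceP; exists (val @^-1` V); first by exists V.
  apply/seteqP; split=> b [+ rb]; move: (rb) => [a _ <-].
  + by move=> Va; split; [exists a => //; exact/WV|exists a].
  + by move=> [a' Wa' <-]; split; [exact/WV|exists a'].
- move=> U oU; apply/open_subspaceP.
  have [->|/set0P[u Uu]] := eqVneq U set0.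
    by exists set0; [exact: open0|rewrite image_set0].
  exists setT; first exact: openT.
  congr (_ `&` _); apply/seteqP; split=> // c _.
  by exists u; rewrite // [RHS]C0; exact: C0.
Qed.
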